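(* Let $\mathcal{G}=(V,E)$ be a finite tree with at least three vertices, with boundary $\delta\Omega$ (the set of vertices of degree one) and interior $\Omega=V\setminus\delta\Omega$, such that $\deg(x)\le D$ for every $x\in V$, where $D$ is a positive integer. If $\deg(x)\geq 3$ for every $x\in\Omega$, then the first nonzero Steklov eigenvalue $\lambda_2$ of $(\mathcal{G},\delta\Omega)$ satisfies $$\lambda_2\leq \frac{8(D-1)}{|V|+2}.$$
   Context: Let $\mathcal{G}=(V,E)$ be a finite tree (simple, undirected, unweighted) with at least three vertices. Its boundary $\delta\Omega$ is the set of vertices of degree one and its interior is $\Omega=V\setminus\delta\Omega$; $|\cdot|$ denotes cardinality. The Steklov problem on $(\mathcal{G},\delta\Omega)$ is: for nonzero $f\in\mathbb{R}^V$ and $\lambda\in\mathbb{R}$, $\Delta f(x)=0$ for $x\in\Omega$ and $\frac{\partial f}{\partial n}(x)=\lambda f(x)$ for $x\in\delta\Omega$, where $(\Delta f)(x)=\sum_{y\sim x}(f(x)-f(y))$ and $\frac{\partial f}{\partial n}(x)=\sum_{y\in\Omega,\,y\sim x}(f(x)-f(y))$. The Steklov eigenvalues are the eigenvalues of the Dirichlet-to-Neumann operator on $\mathbb{R}^{\delta\Omega}$, $f\mapsto \frac{\partial\hat f}{\partial n}$, where $\hat f$ is the harmonic extension of $f$ ($\Delta\hat f=0$ on $\Omega$, $\hat f=f$ on $\delta\Omega$). This operator is self-adjoint and non-negative; its eigenvalues, counted with multiplicity, are ordered $0=\lambda_1\le\lambda_2\le\cdots\le\lambda_{|\delta\Omega|}$.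 *)

(* Defs.v *)
From HB Require Import structures.
From mathcomp Require Import all_boot all_order all_algebra.
From mathcomp Require Import complex.
From mathcomp Require Import boolp classical_sets reals.

Set Implicit Arguments.
Unset Strict Implicit.
Unset Printing Implicit Defensive.
Import Order.TTheory GRing.Theory Num.Theory.
Local Open Scope ring_scope.

Section Graph.
Variables (T : finType) (e : rel T).

(* Since e is symmetric, [:: x; y] is an e-cycle for every edge xy: only the
   duplicate-free cycles with at least three vertices are excluded. *)
Definition is_tree : Prop :=
  [/\ symmetric e, irreflexive e, forall x y, connect e x y &
      forall c : seq T, ucycle e c -> (size c <= 2)%N].

Definition degree (x : T) : nat := #|[set y | e x y]|.
Definition boundary : {set T} := [set x | degree x == 1%N].
Definition interior : {set T} := ~: boundary.
Definition boundary_vertex : finType := {x : T | x \in boundary}.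

End Graph.

Section Steklov.
Variables (R : realType) (T : finType) (e : rel T).
Implicit Types (f : {ffun boundary_vertex e -> R}) (g : {ffun T -> R}).

Definition laplacian g (x : T) : R := \sum_(y | e x y) (g x - g y).

Definition normal_derivative g (x : T) : R :=
  \sum_(y in interior e | e x y) (g x - g y).

Definition is_harmonic_extension f g : Prop :=
  (forall x, x \in interior e -> laplacian g x = 0) /\
  (forall x : boundary_vertex e, g (val x) = f x).

(* Well defined by harmonic_extensionP and harmonic_extension_uniq below. *)
Definition harmonic_extension f : {ffun T -> R} :=
  xget 0 [set g | is_harmonic_extension f g]%classic.

Definition DtN f : {ffun boundary_vertex e -> R} :=
  [ffun x => normal_derivative (harmonic_extension f) (val x)].

(* The matrix of DtN in the basis of indicator functions: column j is the image
   of the indicator function of the j-th boundary vertex. *)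
Definition DtN_matrix : 'M[R]_#|boundary_vertex e| :=
  \matrix_(i, j) DtN [ffun x => (x == enum_val j)%:R] (enum_val i).

Definition is_steklov_spectrum (s : seq R) : Prop :=
  sorted <=%R s /\ char_poly DtN_matrix = \prod_(a <- s) ('X - a%:P).

(* Well defined by steklov_spectrumP and steklov_spectrum_uniq below. *)
Definition steklov_spectrum : seq R :=
  xget [::] [set s | is_steklov_spectrum s]%classic.

(* Numbered from 1, as in lambda_1 <= lambda_2 <= ... *)
Definition steklov_eigenvalue (k : nat) : R := steklov_spectrum`_k.-1.

End Steklov.

Section WellDefined.
Variables (R : realType) (T : finType) (e : rel T).
Hypothesis (e_sym : symmetric e) (e_conn : forall x y, connect e x y).
Implicit Types (f : {ffun boundary_vertex e -> R}) (g h : {ffun T -> R}).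

Lemma harmonic_le0 g : (exists b, b \in boundary e) ->
    (forall x, x \in interior e -> laplacian e g x = 0) ->
    (forall x, x \in boundary e -> g x = 0) ->
  forall x, g x <= 0.
Proof.
move=> [b Bb] gharm g0.
have [m _ mmax] := @arg_maxP _ _ T b xpredT g isT.
suff [c Bc gc] : exists2 c, c \in boundary e & g c = g m.
  by move=> x; rewrite -(g0 c Bc) gc; exact: mmax.
have /connectP[p] := e_conn m b.
elim: p {1 3 4}m (erefl (g m)) => [|y p IH] x gx /=.
  by move=> _ bx; exists b; rewrite // bx.
move=> /andP[exy]; have [Bx _ _|nBx] := boolP (x \in boundary e); first by exists x.
apply: IH.
have := gharm x; rewrite inE nBx => /(_ isT) /eqP.
rewrite psumr_eq0 => [/allP/(_ y)|z _]; last by rewrite gx subr_ge0; exact: mmax.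
by rewrite mem_index_enum exy subr_eq0 gx => /(_ isT)/eqP.
Qed.

Lemma laplacianN g x : laplacian e (- g) x = - laplacian e g x.
Proof.
by rewrite /laplacian -sumrN; apply: eq_bigr => y _; rewrite !ffunE opprD.
Qed.

Lemma laplacianD g h x : laplacian e (g + h) x = laplacian e g x + laplacian e h x.
Proof.
rewrite /laplacian -big_split; apply: eq_bigr => y _ /=.
by rewrite !ffunE opprD addrACA.
Qed.

Lemma laplacianZ (a : R) (g : {ffun T -> R^o}) x :
  laplacian e (a *: g) x = a * laplacian e g x.
Proof.
by rewrite /laplacian mulr_sumr; apply: eq_bigr => y _; rewrite !ffunE mulrBr.
Qed.

Lemma harmonic_eq0 g : (exists b, b \in boundary e) ->
    (forall x, x \in interior e -> laplacian e g x = 0) ->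
    (forall x, x \in boundary e -> g x = 0) -> g = 0.
Proof.
move=> exb gharm g0; apply/ffunP => x; rewrite ffunE; apply/eqP.
rewrite eq_le harmonic_le0 //= -oppr_le0.
have := @harmonic_le0 (- g) exb _ _ x; rewrite ffunE; apply => y yP.
  by rewrite laplacianN gharm ?oppr0.
by rewrite ffunE g0 ?oppr0.
Qed.

Lemma harmonic_extension_uniq f g h : (exists b, b \in boundary e) ->
  is_harmonic_extension f g -> is_harmonic_extension f h -> g = h.
Proof.
move=> exb [gharm gf] [hharm hf]; apply/eqP; rewrite -subr_eq0; apply/eqP.
apply: harmonic_eq0 => // x xP.
  by rewrite laplacianD laplacianN gharm // hharm // subrr.
by rewrite !ffunE (gf (Sub x xP)) (hf (Sub x xP)) subrr.
Qed.

(* R^o is R as a vector space over itself, making {ffun T -> R^o} a vectType. *)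
Definition dirichlet (g : {ffun T -> R^o}) : {ffun T -> R^o} :=
  [ffun x => if x \in boundary e then g x else laplacian e g x].

Fact dirichlet_is_linear : linear dirichlet.
Proof.
move=> a g h; apply/ffunP => x; rewrite !ffunE laplacianD laplacianZ.
by case: ifP.
Qed.
HB.instance Definition _ :=
  GRing.isLinear.Build R _ _ _ dirichlet dirichlet_is_linear.

Lemma harmonic_extension_exists f : (exists b, b \in boundary e) ->
  exists g, is_harmonic_extension f g.
Proof.
move=> exb; pose L : 'End({ffun T -> R^o}) := linfun dirichlet.
have L0 : lker L == 0%VS.
  apply/lker0P => g h; rewrite !lfunE /= => gh.
  apply/eqP; rewrite -subr_eq0; apply/eqP.
  have d0 : dirichlet (g - h) = 0 by rewrite linearB /= gh subrr.
  by apply: harmonic_eq0 => // x; rewrite !inE => /= xP;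
    have /ffunP/(_ x) := d0; rewrite [in LHS]ffunE inE ?xP ?(negbTE xP) => ->;
    rewrite ffunE.
pose f0 : {ffun T -> R^o} := [ffun x => oapp f 0 (insub x)].
exists (L^-1%VF f0); have /ffunP Lg := lker0_lfunVK L0 f0.
split=> [x|[x xP]]; have := Lg x; rewrite lfunE /= !ffunE.
  rewrite [x \in interior e]inE => /[swap] nBx.
  by rewrite (negbTE nBx) insubF ?(negbTE nBx).
by rewrite /= xP => ->; rewrite insubT.
Qed.

Lemma harmonic_extensionP f : (exists b, b \in boundary e) ->
  is_harmonic_extension f (harmonic_extension f).
Proof. by move=> exb; apply: xgetPex; exact: harmonic_extension_exists. Qed.

Lemma green g h :
  (forall x, x \in interior e -> laplacian e g x = 0) ->
  \sum_(x in boundary e) h x * normal_derivative e g x =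
  \sum_x \sum_(y | e x y && ((x \in interior e) || (y \in interior e)))
     h x * (g x - g y).
Proof.
move=> gharm; rewrite [RHS](bigID (mem (boundary e))) /=.
rewrite [X in _ = _ + X]big1 ?addr0 => [|x nBx].
  apply: eq_bigr => x Bx; rewrite /normal_derivative mulr_sumr.
  by apply: eq_bigl => y; rewrite [x \in interior e]inE Bx /= andbC.
transitivity (h x * laplacian e g x); last first.
  by rewrite gharm ?mulr0 // /interior finset.in_setC.
rewrite /laplacian mulr_sumr; apply: eq_bigl => y.
by rewrite [x \in interior e]inE nBx andbT.
Qed.

Lemma green_sym g h :
  (forall x, x \in interior e -> laplacian e g x = 0) ->
  (forall x, x \in interior e -> laplacian e h x = 0) ->
  \sum_(x in boundary e) h x * normal_derivative e g x =
  \sum_(x in boundary e) g x * normal_derivative e h x.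
Proof.
move=> gharm hharm; rewrite !green //.
have split_sum (u v : {ffun T -> R}) :
    \sum_x \sum_(y | e x y && ((x \in interior e) || (y \in interior e)))
      u x * (v x - v y) =
    \sum_x \sum_(y | e x y && ((x \in interior e) || (y \in interior e)))
      u x * v x -
    \sum_x \sum_(y | e x y && ((x \in interior e) || (y \in interior e)))
      u x * v y.
  rewrite -sumrB; apply: eq_bigr => x _; rewrite -sumrB.
  by apply: eq_bigr => y _; rewrite mulrBr.
rewrite !split_sum; congr (_ - _).
  by apply: eq_bigr => x _; apply: eq_bigr => y _; rewrite mulrC.
rewrite (exchange_big_dep xpredT) //=; apply: eq_bigr => x _.
by apply: eq_big => [y|y _]; [rewrite e_sym orbC|exact: mulrC].
Qed.

Lemma DtN_matrix_sym : (DtN_matrix R e)^T = DtN_matrix R e.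
Proof.
apply/matrixP => i j; rewrite !mxE !ffunE.
have exb : exists b, b \in boundary e.
  by exists (val (enum_val i)); exact: valP.
pose d (k : 'I_#|boundary_vertex e|) : {ffun boundary_vertex e -> R} :=
  [ffun x => (x == enum_val k)%:R].
have E (k : 'I_#|boundary_vertex e|) u :
    \sum_(x in boundary e) harmonic_extension (d k) x * u x =
    u (val (enum_val k)).
  have [_ dk] := harmonic_extensionP (d k) exb.
  have kP := valP (enum_val k).
  rewrite (bigD1 (val (enum_val k))) //= dk ffunE eqxx mul1r.
  rewrite big1 ?addr0 // => x /andP[Bx xk].
  rewrite (dk (Sub x Bx)) ffunE -val_eqE /= (negbTE xk) mul0r //.
rewrite -[LHS](E j) -[RHS](E i); apply: green_sym.
  by have [] := harmonic_extensionP (d i) exb.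
by have [] := harmonic_extensionP (d j) exb.
Qed.

End WellDefined.

Lemma symmetric_char_poly_split (R : rcfType) n (A : 'M[R]_n) : A^T = A ->
  exists s : seq R, sorted <=%R s /\ char_poly A = \prod_(a <- s) ('X - a%:P).
Proof.
move=> symA; pose toC : R -> R[i] := real_complex R.
pose B := map_mx toC A.
have Bherm : B \is hermsymmx.
  apply: realsym_hermsym.
    by apply/is_hermitianmxP; rewrite expr0 scale1r map_mx_id // map_trmx symA.
  by apply/mxOverP => i j; rewrite mxE; apply/complex_realP; exists (A i j).
have /mxOverP spR := hermitian_spectral_diag_real Bherm.
have /hermitian_normalmx/orthomx_spectralP Beq := Bherm.
set P := spectralmx B in Beq; set sp := spectral_diag B in Beq spR.
have Pu : P \in unitmx by exact: spectral_unit.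
pose s : seq R := [seq complex.Re (sp 0 i) | i <- enum 'I_n].
exists (sort <=%R s); split; first exact: (sort_sorted le_total).
rewrite (perm_big s) /=; last by rewrite perm_sort.
apply: (map_poly_inj (real_complex R : {rmorphism _ -> _})).
rewrite map_char_poly rmorph_prod /= big_map big_enum /=.
have -> : char_poly (map_mx toC A) = char_poly (diag_mx sp).
  rewrite -/B Beq /char_poly.
  pose Q := map_mx (@polyC R[i]) P; pose Qi := map_mx (@polyC R[i]) (invmx P).
  have QiQ : Qi *m Q = 1%:M by rewrite -map_mxM mulVmx // map_mx1.
  have -> : char_poly_mx (invmx P *m diag_mx sp *m P) =
            Qi *m char_poly_mx (diag_mx sp) *m Q.
    rewrite /char_poly_mx !map_mxM mulmxBr mulmxBl -/Q -/Qi; congr (_ - _).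
    by rewrite scalar_mxC -mulmxA QiQ mulmx1.
  by rewrite !det_mulmx mulrAC -det_mulmx QiQ det1 mul1r.
rewrite char_poly_trig ?diag_mx_is_trig //; apply: eq_bigr => i _.
rewrite !mxE eqxx mulr1n rmorphB /= map_polyX map_polyC /=.
by have /complex_realP[a ->] := spR 0 i.
Qed.

Lemma steklov_spectrum_exists (R : realType) (T : finType) (e : rel T) :
  symmetric e -> (forall x y, connect e x y) ->
  exists s : seq R, is_steklov_spectrum e s.
Proof. by move=> *; apply: symmetric_char_poly_split; exact: DtN_matrix_sym. Qed.

Lemma steklov_spectrum_uniq (R : realType) (T : finType) (e : rel T)
    (s t : seq R) :
  is_steklov_spectrum e s -> is_steklov_spectrum e t -> s = t.
Proof.
move=> [ss ps] [st pt]; apply: (sorted_eq le_trans le_anti) => //.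
by apply: prod_XsubC_eq; rewrite -ps -pt.
Qed.

Lemma steklov_spectrumP (R : realType) (T : finType) (e : rel T) :
  symmetric e -> (forall x y, connect e x y) ->
  is_steklov_spectrum e (steklov_spectrum R e) /\
  size (steklov_spectrum R e) = #|boundary e|.
Proof.
move=> e_sym e_conn.
have sP : is_steklov_spectrum e (steklov_spectrum R e).
  by apply: xgetPex; exact: steklov_spectrum_exists.
split=> //; have [_ /(congr1 (fun p : {poly R} => size p))] := sP.
by rewrite size_char_poly size_prod_XsubC card_sig => -[<-]; apply: eq_card => x.
Qed.

(* Main.v *)
Require Import Defs.
From mathcomp Require Import all_boot all_order all_algebra.
From mathcomp Require Import reals.
From mathcomp Require Import fingroup perm complex ring lra zify.
Set Implicit Arguments.
Unset Strict Implicit.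
Unset Printing Implicit Defensive.
Import Order.TTheory GRing.Theory Num.Theory.

(** Cut one edge uv of the tree. It leaves two components, holding a and b
    boundary vertices, and the functions that are constant on each component
    form a plane on which the Dirichlet energy is at most (1/a + 1/b) times the
    squared boundary norm: if the two values are s and t, the energy is
    (s - t)^2, the norm is a s^2 + b t^2, and this is Cauchy-Schwarz. Harmonic
    extension only lowers the energy, so the Courant-Fischer principle
    ([courant_fischer_le]) gives lambda_2 <= 1/a + 1/b; [steklov_cut_le] is this
    bound for a cut of any number of edges.

    It remains to find an edge whose cut is balanced. Write [branch u v] for the
    component of v once u is deleted, and L for the number of boundary vertices.
    Take a smallest branch [branch u v] with at least L/2 boundary vertices.
    The branches [branch v w] hanging from it are smaller, hence hold fewer than
    L/2 boundary vertices each; but there are at most D - 1 of them and together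
    they hold at least L/2, so one of them holds a >= L / (2 (D - 1)), leaving
    b >= L/2 on the other side ([balanced_edge]). Therefore
    lambda_2 <= L / (a b) <= 4 (D - 1) / L.

    Finally |V| + 2 <= 2 L when all interior degrees are at least three
    ([card_tree_le]). This follows by induction on branches from
    |S| + 1 <= 2 (number of boundary vertices in S): an interior v has at least
    two child branches, and each has one unit of slack. *)

(** * The Courant-Fischer upper bound *)

Local Open Scope ring_scope.
Local Open Scope sesquilinear_scope.

Lemma char_poly_similar (K : comUnitRingType) n (P A : 'M[K]_n) :
  P \in unitmx -> char_poly (invmx P *m A *m P) = char_poly A.
Proof.
move=> Pu; pose Q := map_mx polyC P; pose Qi := map_mx polyC (invmx P).
have QiQ : Qi *m Q = 1%:M by rewrite -map_mxM mulVmx // map_mx1.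
rewrite /char_poly.
have -> : char_poly_mx (invmx P *m A *m P) = Qi *m char_poly_mx A *m Q.
  rewrite /char_poly_mx !map_mxM mulmxBr mulmxBl -/Q -/Qi; congr (_ - _).
  by rewrite scalar_mxC -mulmxA QiQ mulmx1.
by rewrite !det_mulmx mulrAC -det_mulmx QiQ det1 mul1r.
Qed.

Lemma perm_eq_enum_perm (U : eqType) (x0 : U) n (s : seq U) (F : 'I_n -> U) :
    perm_eq s [seq F i | i <- enum 'I_n] ->
  exists sigma : 'S_n, forall i, F (sigma i) = nth x0 s i.
Proof.
move=> sF; have /tuple_permP[sigma sE] : perm_eq s [tuple F i | i < n] by [].
exists sigma => i; rewrite sE (nth_map i) ?size_enum_ord // tnth_mktuple.
by rewrite nth_ord_enum.
Qed.

Section Spectral.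
Variable R : rcfType.

(** For real symmetric Q the cross terms of z = x + iy cancel, so that
    z Q z* = x Q x^T + y Q y^T. *)
Lemma hermitian_form_ge0 m (Q : 'M[R]_m) (z : 'rV[R[i]]_m) :
    Q^T = Q -> (forall x : 'rV_m, 0 <= (x *m Q *m x^T) 0 0) ->
  0 <= (z *m map_mx (real_complex R) Q *m z^t*) 0 0.
Proof.
move=> Qsym Qge0; pose x := map_mx (@complex.Re R) z; pose y := map_mx (@complex.Im R) z.
pose C := @map_mx _ _ (real_complex R).
have zE : z = C _ _ x + 'i%C *: C _ _ y.
  by apply/matrixP => i j; rewrite !mxE [LHS]complexE.
have zcE : z^t* = C _ _ x^T - 'i%C *: C _ _ y^T.
  apply/matrixP => i j; rewrite !mxE; case: (z j i) => a b.
  by apply/eqP; rewrite eq_complex /=; apply/andP; split; apply/eqP; ring.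
have xQy : x *m Q *m y^T = y *m Q *m x^T.
  apply/matrixP => i j; rewrite !ord1.
  by rewrite -[in LHS](trmxK (x *m Q *m y^T)) mxE !trmx_mul trmxK Qsym mulmxA.
suff -> : z *m C _ _ Q *m z^t* = C _ _ (x *m Q *m x^T) + C _ _ (y *m Q *m y^T).
  by rewrite /C -map_mxD mxE ler0c mxE addr_ge0.
rewrite zcE zE /C !map_mxM !mulmxDl !mulmxBr -!scalemxAl -!scalemxAr -!map_mxM xQy.
rewrite scalerA -expr2 sqr_i scaleN1r opprK.
by rewrite addrA subrK.
Qed.

(** The upper half of the Courant-Fischer principle, with eigenvalues numbered
    from 0: W spans a space of dimension k + 1 on which the Rayleigh quotient is
    at most c. The eigenbasis comes from the spectral theorem for hermitian
    matrices, so a vector of W orthogonal to the k lowest eigenvectors has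
    complex coordinates; [hermitian_form_ge0] extends the hypothesis to it. *)
Lemma courant_fischer_le n k (A : 'M[R]_n) (s : seq R) (c : R)
    (W : 'M[R]_(k.+1, n)) :
    A^T = A -> sorted <=%R s -> char_poly A = \prod_(a <- s) ('X - a%:P) ->
    row_free W ->
    (forall x : 'rV_k.+1,
       (x *m (W *m A *m W^T) *m x^T) 0 0 <= c * (x *m (W *m W^T) *m x^T) 0 0) ->
  s`_k <= c.
Proof.
move=> Asym s_sorted sA Wfree Wc; rewrite leNgt; apply/negP => c_lt.
pose toC := real_complex R; pose B := map_mx toC A.
have Bherm : B \is hermsymmx.
  apply: realsym_hermsym.
    by apply/is_hermitianmxP; rewrite expr0 scale1r map_mx_id // map_trmx Asym.
  by apply/mxOverP => i j; rewrite mxE; apply/complex_realP; exists (A i j).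
have /mxOverP spR := hermitian_spectral_diag_real Bherm.
have /hermitian_normalmx/orthomx_spectralP := Bherm.
have Puni := spectral_unitarymx B; rewrite invmx_unitary //.
set P := spectralmx B in Puni *; set sp := spectral_diag B in spR *.
move=> Beq; pose F i := complex.Re (sp 0 i).
have spF i : sp 0 i = toC (F i).
  by have /complex_realP[a spi] := spR 0 i; rewrite /F spi.
have PP : P *m P^t* = 1%:M by apply/unitarymxP.
have PP' : P^t* *m P = 1%:M by apply: mulmx1C.
have sF : perm_eq s [seq F i | i <- enum 'I_n].
  apply: prod_XsubC_eq; rewrite -sA big_map big_enum /=.
  apply: (map_poly_inj (real_complex R : {rmorphism _ -> _})).
  rewrite map_char_poly rmorph_prod /= -/B Beq -invmx_unitary //.
  rewrite char_poly_similar ?unitarymx_unit // char_poly_trig ?diag_mx_is_trig //.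
  apply: eq_bigr => i _.
  by rewrite rmorphB /= map_polyX map_polyC /= mxE eqxx mulr1n spF.
(* sigma lists the spectral directions by increasing eigenvalue. *)
have [sigma sigmaE] := perm_eq_enum_perm 0 sF.
have szs : size s = n by rewrite (perm_size sF) size_map size_enum_ord.
have k_lt : (k < n)%N by rewrite -(eqP Wfree) rank_leq_col.
pose WC := map_mx toC W.
(* k linear conditions on k + 1 unknowns: z W is nonzero and orthogonal to the
   spectral directions of the k smallest eigenvalues. *)
pose f (i : 'I_k) := sigma (widen_ord (ltnW k_lt) i).
pose N := WC *m colsub f (P^t*).
have : kermx N != 0.
  by rewrite -mxrank_eq0 mxrank_ker subn_eq0 -ltnNge ltnS rank_leq_col.
rewrite -nz_row_eq0; set z := nz_row _ => z_neq0.
have zN : z *m N = 0 by apply/sub_kermxP; exact: nz_row_sub.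
pose h := z *m WC *m P^t*.
have hf i : (sigma^-1%g i < k)%N -> h 0 i = 0.
  move=> lt_k; have /rowP/(_ (Ordinal lt_k)) := zN.
  rewrite mulmxA mulmx_colsub -/h mxE [RHS]mxE /f.
  by rewrite (_ : widen_ord _ _ = sigma^-1%g i) ?permKV //; exact: val_inj.
pose Q := c *: (W *m W^T) - W *m A *m W^T.
have Qsym : Q^T = Q.
  by rewrite /Q linearB linearZ /= !trmx_mul trmxK Asym mulmxA.
have Qge0 (x : 'rV_k.+1) : 0 <= (x *m Q *m x^T) 0 0.
  rewrite mulmxBr mulmxBl -scalemxAr -scalemxAl.
  by rewrite mxE [X in X + _]mxE [X in _ + X]mxE subr_ge0; exact: Wc.
have := hermitian_form_ge0 z Qsym Qge0.
have WCt : map_mx toC W^T = WC^t*.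
  by apply/matrixP => i j; rewrite !mxE; apply/esym/CrealP/complex_realP; exists (W j i).
have ht : h^t* = P *m WC^t* *m z^t*.
  by rewrite /h !trmx_mul !map_mxM !trmxCK mulmxA.
have -> : z *m map_mx toC Q *m z^t* = h *m ((toC c)%:M - diag_mx sp) *m h^t*.
  rewrite ht /Q map_mxB map_mxZ !map_mxM /= -/B -/WC WCt Beq /h.
  rewrite !(mulmxBl, mulmxBr) mul_mx_scalar -!scalemxAl -!scalemxAr -!scalemxAl !mulmxA.
  by congr (_ *: _ - _); rewrite -!mulmxA (mulmxA (P^t*)) PP' mul1mx.
have -> : (h *m ((toC c)%:M - diag_mx sp) *m h^t*) 0 0 =
          - \sum_i toC (F i - c) * `|h 0 i| ^+ 2.
  rewrite mxE -sumrN; apply: eq_bigr => i _.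
  rewrite mulmxBr mul_mx_scalar mul_mx_diag !mxE spF normCK /toC rmorphB /=.
  by move: (\sum_j _) => q; ring.
(* The hypothesis makes this sum nonpositive, although every term is
   nonnegative, and positive as soon as h 0 i is nonzero. *)
have term_ge0 i : 0 <= toC (F i - c) * `|h 0 i| ^+ 2.
  have [lt_k|ge_k] := ltnP (sigma^-1%g i) k; first by rewrite hf // normr0 expr0n mulr0.
  rewrite mulr_ge0 ?exprn_ge0 // ler0c subr_ge0 -(permKV sigma i) sigmaE.
  rewrite (le_trans (ltW c_lt)) // (sorted_leq_nth le_trans le_refl) ?inE ?szs //.
rewrite oppr_ge0 => sum_le0.
have /eqP : \sum_i toC (F i - c) * `|h 0 i| ^+ 2 = 0.
  by apply/eqP; rewrite eq_le sum_le0 sumr_ge0.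
rewrite psumr_eq0 // => /allP h0.
have {}h0 : h = 0.
  apply/rowP => i; rewrite [RHS]mxE.
  have [lt_k|ge_k] := ltnP (sigma^-1%g i) k; first exact: hf.
  have := h0 i; rewrite mem_index_enum mulf_eq0 expf_eq0 normr_eq0 /= => /(_ isT).
  case/orP=> [|/eqP //]; rewrite fmorph_eq0 subr_eq0 -(permKV sigma i) sigmaE.
  rewrite gt_eqF // (lt_le_trans c_lt) // (sorted_leq_nth le_trans le_refl) ?inE ?szs //.
have WCfree : row_free WC by rewrite /row_free mxrank_map.
have : z *m WC = 0 by rewrite -[LHS]mulmx1 -PP' mulmxA -/h h0 mul0mx.
by move/eqP; rewrite mulmx_free_eq0 // (negbTE z_neq0).
Qed.
End Spectral.

(** * A variational bound from cuts *)

Section Energy.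
Variables (R : realType) (T : finType) (e : rel T).
Hypotheses (e_sym : symmetric e) (e_conn : forall x y, connect e x y).
Implicit Types (f : {ffun boundary_vertex e -> R}) (g h : {ffun T -> R}).

(** The edges that the normal derivative sees: it sums over interior neighbours,
    so edges joining two boundary vertices are left out. *)
Definition steklov_edge (x y : T) : bool :=
  e x y && ((x \in interior e) || (y \in interior e)).

(** Twice the usual Dirichlet form, as each edge is counted in both directions;
    hence the factors 2 below. *)
Definition dirichlet_form g h : R :=
  \sum_x \sum_(y | steklov_edge x y) (g x - g y) * (h x - h y).

Lemma dirichlet_form_harmonic g h :
    (forall x, x \in interior e -> laplacian e h x = 0) ->
  dirichlet_form g h =
  2 * \sum_(x in boundary e) g x * normal_derivative e h x.
Proof.
move=> hharm; rewrite green // -/(steklov_edge _ _).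
have swap : \sum_x \sum_(y | steklov_edge x y) g x * (h x - h y) =
    \sum_x \sum_(y | steklov_edge x y) - g y * (h x - h y).
  rewrite (exchange_big_dep xpredT) //=; apply: eq_bigr => x _.
  apply: eq_big => [y|y _]; first by rewrite /steklov_edge e_sym orbC.
  by rewrite mulNr -mulrN opprB.
rewrite mulr2n mulrDl !mul1r [X in _ = X + _]swap -big_split /=.
apply: eq_bigr => x _; rewrite -big_split /=.
by apply: eq_bigr => y _; rewrite -mulrDl addrC.
Qed.

(** Dirichlet's principle. If u is the harmonic extension of f, the form D
    satisfies D(g, u) = D(u, u) by [dirichlet_form_harmonic], since g and u agree
    on the boundary; then 2 D(g, u) <= D(g, g) + D(u, u) gives
    D(u, u) <= D(g, g). *)
Lemma DtN_form_le f g :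
    (forall x : boundary_vertex e, g (val x) = f x) ->
  2 * \sum_x f x * DtN f x <= \sum_x \sum_(y | e x y) (g x - g y) ^+ 2.
Proof.
move=> gf.
have [b Bb|noB] := pickP (mem (boundary e)); last first.
  rewrite big1 => [|x _]; last by have := noB (val x); rewrite /= (valP x).
  by rewrite mulr0; apply: sumr_ge0 => x _; apply: sumr_ge0 => y _; rewrite sqr_ge0.
have exb : exists b, b \in boundary e by exists b.
have [] := harmonic_extensionP e_conn f exb.
set u := harmonic_extension f => uharm uf.
have qE (h : {ffun T -> R}) : (forall x : boundary_vertex e, h (val x) = f x) ->
    2 * \sum_x f x * DtN f x = dirichlet_form h u.
  move=> hf; rewrite dirichlet_form_harmonic // [in RHS]big_sub /=; congr (_ * _).
  by apply: eq_bigr => x _; rewrite -hf ffunE.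
have le_u : dirichlet_form u u <= dirichlet_form g g.
  have : 2 * dirichlet_form g u <= dirichlet_form g g + dirichlet_form u u.
    rewrite mulr_sumr -big_split; apply: ler_sum => x _ /=.
    rewrite mulr_sumr -big_split; apply: ler_sum => y _ /=.
    by rewrite -subr_ge0; have := sqr_ge0 ((g x - g y) - (u x - u y)); nra.
  by rewrite -(qE g gf) (qE u uf); lra.
rewrite (qE u uf) (le_trans le_u) //; apply: ler_sum => x _.
rewrite [leRHS](bigID (steklov_edge x)) /= -[leLHS]addr0 lerD //.
  rewrite le_eqVlt; apply/orP; left; apply/eqP; apply: eq_big => [y|y _]; last first.
    by rewrite expr2.
  by rewrite /steklov_edge; case: (e x y).
by apply: sumr_ge0 => y _; rewrite sqr_ge0.
Qed.

(** Linearity of harmonic extension: the combination of the extensions of the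
    indicator functions is harmonic with boundary values f, so uniqueness
    identifies it with the extension of f. *)
Lemma DtN_matrixE f i :
  DtN f (enum_val i) = \sum_j f (enum_val j) * DtN_matrix R e i j.
Proof.
have exb : exists b, b \in boundary e by exists (val (enum_val i)); exact: valP.
pose d (j : 'I_#|boundary_vertex e|) : {ffun boundary_vertex e -> R} :=
  [ffun x => (x == enum_val j)%:R].
pose u := [ffun x => \sum_j f (enum_val j) * harmonic_extension (d j) x].
have -> : DtN f (enum_val i) = normal_derivative e u (val (enum_val i)).
  rewrite ffunE; congr (normal_derivative _ _ _).
  apply: (harmonic_extension_uniq e_conn exb (harmonic_extensionP e_conn f exb)).
  split=> [x xI|x].
    rewrite /laplacian; under eq_bigr do rewrite !ffunE -sumrB.
    rewrite exchange_big big1 //= => j _; under eq_bigr do rewrite -mulrBr.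
    rewrite -mulr_sumr; have [/(_ x xI) + _] := harmonic_extensionP e_conn (d j) exb.
    by rewrite /laplacian => ->; rewrite mulr0.
  rewrite ffunE (bigD1 (enum_rank x)) //= enum_rankK.
  have dx j := (harmonic_extensionP e_conn (d j) exb).2 x.
  rewrite dx ffunE enum_rankK eqxx mulr1 big1 ?addr0 // => j jx.
  rewrite dx ffunE; case: eqP => [xj|_]; last by rewrite mulr0.
  by rewrite xj enum_valK eqxx in jx.
rewrite /normal_derivative; under eq_bigr do rewrite !ffunE -sumrB.
rewrite exchange_big; apply: eq_bigr => j _ /=; rewrite !mxE ffunE /normal_derivative.
by rewrite mulr_sumr; apply: eq_bigr => y _; rewrite mulrBr.
Qed.

Lemma DtN_matrix_form (v : 'rV[R]_#|boundary_vertex e|) :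
  (v *m DtN_matrix R e *m v^T) 0 0 =
  \sum_x v 0 (enum_rank x) * DtN [ffun x => v 0 (enum_rank x)] x.
Proof.
rewrite mxE [RHS](reindex (@enum_val (boundary_vertex e) predT)) /=; last first.
  by apply: onW_bij; exact: enum_val_bij.
apply: eq_bigr => j _; rewrite enum_valK DtN_matrixE !mxE mulrC; congr (_ * _).
apply: eq_bigr => k _; rewrite ffunE enum_valK; congr (_ * _).
by rewrite -[in LHS](DtN_matrix_sym R e_sym e_conn) [LHS]mxE.
Qed.

(** Courant-Fischer on the plane of boundary functions that are constant on each
    side of the cut. Extending them to T by the same two values x0 and x1 gives
    the energy m (x1 - x0)^2, where m is the number of cut edges. *)
Lemma steklov_cut_le (S : {set T}) :
    (0 < #|boundary e :&: S|)%N -> (0 < #|boundary e :\: S|)%N ->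
  steklov_eigenvalue R e 2 <=
    #|[set p : T * T | [&& e p.1 p.2, p.1 \in S & p.2 \notin S]]|%:R *
    (#|boundary e :&: S|%:R^-1 + #|boundary e :\: S|%:R^-1).
Proof.
set m := #|[set p : T * T | _]|; set a := #|boundary e :&: S|.
set b := #|boundary e :\: S| => a_gt0 b_gt0.
have [[s_sorted sE] _] := steklov_spectrumP R e_sym e_conn.
pose side x : 'I_2 := inord (x \in S).
have sideE x : side x = (x \in S) :> nat by rewrite inordK //; case: (x \in S).
pose W : 'M[R]_(2, #|boundary_vertex e|) :=
  \matrix_(i, j) (i == side (val (enum_val j)))%:R.
have WE (x : 'rV_2) j : (x *m W) 0 j = x 0 (side (val (enum_val j))).
  rewrite mxE (bigD1 (side (val (enum_val j)))) //= mxE eqxx mulr1 big1 ?addr0 //.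
  by move=> i /negbTE ne; rewrite mxE ne mulr0.
apply: (courant_fischer_le (W := W) (DtN_matrix_sym R e_sym e_conn) s_sorted sE).
  apply: inj_row_free => x /rowP xW0; apply/rowP => i; rewrite [RHS]mxE.
  have [y yB iE] : exists2 y, y \in boundary e & i = side y.
    have [i1|i0] := boolP (i == 1).
      move: a_gt0; rewrite card_gt0 => /set0Pn[y]; rewrite inE => /andP[yB yS].
      by exists y => //; apply: val_inj; rewrite /= sideE yS (eqP i1).
    move: b_gt0; rewrite card_gt0 => /set0Pn[y]; rewrite inE => /andP[yS yB].
    exists y => //; apply: val_inj; rewrite /= sideE (negbTE yS) /=.
    by case: i i0 => -[|[|//]] // lt; rewrite -val_eqE.
  have := xW0 (enum_rank (Sub y yB : boundary_vertex e)).
  by rewrite WE enum_rankK SubK -iE mxE.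
move=> x; set x0 := x 0 0; set x1 := x 0 1.
have sideS y : x 0 (side y) = if y \in S then x1 else x0.
  by case: ifP => yS; congr (x 0 _); apply: val_inj; rewrite /= sideE yS.
rewrite !mulmxA -!(mulmxA _ W^T) -!trmx_mul -!(mulmxA (x *m W)) mulmxA.
have -> : (x *m W *m (x *m W)^T) 0 0 = a%:R * x1 ^+ 2 + b%:R * x0 ^+ 2.
  rewrite mxE (reindex (@enum_rank (boundary_vertex e))) /=; last first.
    by apply: onW_bij; exact: enum_rank_bij.
  under eq_bigr => y do rewrite [X in _ * X]mxE WE enum_rankK sideS -expr2.
  rewrite -(big_sub _ (fun y => (if y \in S then x1 else x0) ^+ 2)) (bigID (mem S)) /=.
  congr (_ + _).
    rewrite (eq_bigr (fun=> x1 ^+ 2)) => [|y /andP[_ ->] //].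
    rewrite sumr_const mulr_natl; congr (_ *+ _).
    by apply: eq_card => y; rewrite [RHS]finset.in_setI.
  rewrite (eq_bigr (fun=> x0 ^+ 2)) => [|y /andP[_ /negbTE ->] //].
  rewrite sumr_const mulr_natl; congr (_ *+ _).
  by apply: eq_card => y; rewrite [RHS]finset.in_setD andbC.
rewrite DtN_matrix_form.
set f := [ffun y => _].
have fE (y : boundary_vertex e) : [ffun y => x 0 (side y)] (val y) = f y.
  by rewrite !ffunE WE enum_rankK.
have := DtN_form_le fE.
set g := [ffun y => _].
have -> : \sum_y \sum_(z | e y z) (g y - g z) ^+ 2 = 2 * m%:R * (x1 - x0) ^+ 2.
  (* t keeps the edges directed out of S; the energy also has their reverses. *)
  pose t y z : R := ((y \in S) && (z \notin S))%:R * (x1 - x0) ^+ 2.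
  have tm : \sum_y \sum_(z | e y z) t y z = m%:R * (x1 - x0) ^+ 2.
    rewrite pair_big_dep /= -mulr_suml -natr_sum /m -sum1_card; congr (_%:R * _).
    by rewrite [LHS]big_mkcond [RHS]big_mkcond; apply: eq_bigr => p _;
      rewrite inE; case: ifP.
  transitivity (\sum_y \sum_(z | e y z) t y z + \sum_y \sum_(z | e y z) t z y).
    rewrite -big_split; apply: eq_bigr => y _ /=.
    rewrite -big_split; apply: eq_bigr => z _ /=.
    by rewrite !ffunE !sideS /t; case: (y \in S); case: (z \in S) => /=; ring.
  rewrite [X in _ + X](exchange_big_dep xpredT) //=.
  rewrite [X in _ + X](_ : _ = \sum_y \sum_(z | e y z) t y z).
    by rewrite tm; ring.
  by apply: eq_bigr => y _; apply: eq_bigl => z; rewrite e_sym.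
under eq_bigr do rewrite {1}/f ffunE.
move: (\sum_y _) => q qle.
have {qle} : q <= m%:R * (x1 - x0) ^+ 2 by lra.
move/le_trans; apply; rewrite -mulrA ler_wpM2l ?ler0n //.
have a0 : 0 < a%:R :> R by rewrite ltr0n.
have b0 : 0 < b%:R :> R by rewrite ltr0n.
rewrite -subr_ge0.
have -> : (a%:R^-1 + b%:R^-1) * (a%:R * x1 ^+ 2 + b%:R * x0 ^+ 2) - (x1 - x0) ^+ 2 =
          (a%:R * x1 + b%:R * x0) ^+ 2 / (a%:R * b%:R).
  by field; rewrite !gt_eqF.
by rewrite divr_ge0 ?sqr_ge0 // mulr_ge0.
Qed.

End Energy.

Local Close Scope ring_scope.
Local Close Scope sesquilinear_scope.

(** * Branches of a tree *)

Lemma connect_invariant (T : finType) (r : rel T) (P : pred T) x y :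
    connect r x y -> P x ->
    (forall a b, connect r x a -> P a -> r a b -> P b) ->
  P y.
Proof.
move=> /connectP[p rp ->] Px PS; elim/last_ind: p rp => //= p z IH.
rewrite rcons_path last_rcons => /andP[rp rz]; apply: PS (IH rp) rz.
by apply/connectP; exists p.
Qed.

Section Branch.
Variables (T : finType) (e : rel T).
Hypothesis e_tree : is_tree e.

Let e_sym : symmetric e. Proof. by case: e_tree. Qed.
Let e_irr : irreflexive e. Proof. by case: e_tree. Qed.
Let e_conn x y : connect e x y. Proof. by case: e_tree. Qed.

Let edge_neq x y : e x y -> x != y.
Proof. by apply: contraTneq => ->; rewrite e_irr. Qed.

Definition avoiding (u : T) : rel T := [rel x y | [&& e x y, x != u & y != u]].

(** For an edge uv of a tree this is also the component of v once the edge uv is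
    removed. Deleting the vertex u instead excludes u from the branch at once
    ([branch_avoids]). *)
Definition branch (u v : T) : {set T} := [set x | connect (avoiding u) v x].

Lemma mem_branch u v : v \in branch u v.
Proof. by rewrite inE connect0. Qed.

Lemma branch_avoids u v x : v != u -> x \in branch u v -> x != u.
Proof.
rewrite inE => vu vx.
by apply: (connect_invariant (P := fun x => x != u) vx vu) => a b _ _ /and3P[].
Qed.

Lemma branch_step u v x y : v != u ->
  x \in branch u v -> e x y -> y != u -> y \in branch u v.
Proof.
move=> vu xb exy yu; have xu := branch_avoids vu xb.
by move: xb; rewrite !inE => /connect_trans; apply; exact/connect1/and3P.
Qed.

(** A path from v to a second neighbour x of u that avoids u would close up
    through u to a cycle. *)
Lemma branch_neighbor u v x : e u v -> e u x -> x \in branch u v -> x = v.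
Proof.
move=> euv eux; rewrite inE => /connectP[p0 /shortenP[p pp p_uniq _] xE].
have [_ _ _ /(_ [:: u, v & p])] := e_tree.
have pu : all (fun y => y != u) (v :: p).
  rewrite /= eq_sym edge_neq //=; elim: p v {euv p_uniq xE} pp => //= y p IH v.
  by case/andP=> /and3P[_ _ ->] /IH.
have ep : path e v p by apply: sub_path pp => a b /and3P[].
rewrite /ucycle /= rcons_path ep -xE euv (e_sym x) eux /=.
move: p_uniq; rewrite /= => /andP[-> ->].
have -> : u \notin v :: p by apply/negP => /(allP pu); rewrite eqxx.
by case: p xE {pp pu ep} => // y p _ /(_ isT).
Qed.

Lemma branch_neighbor_eq v w w' x : e v w -> e v w' ->
  x \in branch v w -> x \in branch v w' -> w = w'.
Proof.
move=> ew ew' xw xw'; apply: (branch_neighbor ew' ew).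
move: xw xw'; rewrite !inE => wx w'x; apply: connect_trans w'x _.
rewrite sym_connect_sym // => a b; rewrite /avoiding /= e_sym.
by congr (_ && _); exact: andbC.
Qed.

(** A path from w that avoids v cannot reach u either, as u would then be a second
    neighbour of v in [branch v w]. *)
Lemma branch_child_proper u v w : e u v -> e v w -> w != u ->
  branch v w \proper branch u v.
Proof.
move=> euv evw wu; have vu : v != u by rewrite eq_sym edge_neq.
have wv : w != v by rewrite eq_sym edge_neq.
apply/properP; split; last first.
  by exists v; [exact: mem_branch|apply/negP => /(branch_avoids wv); rewrite eqxx].
apply/subsetP => x; rewrite inE => wx; apply: (connect_invariant wx).
  exact: branch_step (mem_branch u v) evw wu.
move=> a b wa ab /and3P[eab _ bv]; apply: (branch_step vu ab eab).
apply: contra_neq wu => bu; rewrite -bu; apply/esym.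
apply: (branch_neighbor evw); first by rewrite e_sym bu.
by apply: (branch_step wv _ eab bv); rewrite inE.
Qed.

Lemma branch_childE u v x : e u v -> x \in branch u v -> x != v ->
  exists w, [/\ e v w, w != u & x \in branch v w].
Proof.
move=> euv; rewrite inE => vx xv; have vu : v != u by rewrite eq_sym edge_neq.
pose P y := (y == v) || [exists w, [&& e v w, w != u & y \in branch v w]].
have : P x.
  apply: (connect_invariant vx); first by rewrite /P eqxx.
  move=> a b va Pa /and3P[eab au bu]; rewrite /P; case: eqP => //= /eqP bv.
  apply/existsP; case/orP: Pa => [/eqP av|/existsP[w /and3P[evw wu aw]]].
    by exists b; rewrite -av eab bu mem_branch.
  exists w; rewrite evw wu (branch_step _ aw eab bv) //.
  by rewrite eq_sym edge_neq.
by rewrite /P (negbTE xv) => /existsP[w /and3P[]]; exists w.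
Qed.

Lemma branch_opposite u v : e u v -> branch v u = ~: branch u v.
Proof.
move=> euv; have vu : v != u by rewrite eq_sym edge_neq.
have evu : e v u by rewrite e_sym.
apply/setP => x; rewrite in_setC; apply/idP/idP => [xu|xv].
  apply/negP => xv; have [|w [evw wu xw]] := branch_childE euv xv.
    by apply: branch_avoids xu; rewrite eq_sym.
  by move: wu; rewrite (branch_neighbor_eq evw evu xw xu) eqxx.
pose P y := (y \in branch v u) || (y \in branch u v).
suff : P x by rewrite /P (negbTE xv) orbF.
apply: (connect_invariant (e_conn u x)); first by rewrite /P mem_branch.
rewrite /P => a b _ /orP[ab|ab] eab.
  have [->|bv] := eqVneq b v; first by rewrite mem_branch orbT.
  by rewrite (branch_step _ ab eab bv) // eq_sym.
have [->|bu] := eqVneq b u; first by rewrite mem_branch.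
by rewrite (branch_step _ ab eab bu) ?orbT.
Qed.

(** Only v and u are adjacent across the cut, by [branch_neighbor]. *)
Lemma card_branch_cut u v : e u v ->
  #|[set p : T * T | [&& e p.1 p.2, p.1 \in branch u v & p.2 \notin branch u v]]| <= 1.
Proof.
move=> euv; rewrite -(cards1 (v, u)); apply/subset_leq_card/subsetP => -[x y].
rewrite in_set in_set1 /= => /and3P[exy xb yb]; have vu : v != u by rewrite eq_sym edge_neq.
have yu : y = u by apply: contraNeq yb => yu; exact: branch_step exy yu.
by rewrite yu (branch_neighbor euv _ xb) // -yu e_sym.
Qed.

(** The branch is the disjoint union of v and its child branches: they cover it
    by [branch_childE] and are disjoint by [branch_neighbor_eq]. *)
Lemma card_setI_branch (A : {set T}) u v : e u v ->
  #|A :&: branch u v| = (v \in A) + \sum_(w | e v w && (w != u)) #|A :&: branch v w|.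
Proof.
move=> euv.
have cardE (B : {set T}) : #|A :&: B| = \sum_(x in A) (x \in B).
  rewrite -sum1_card [RHS]big_mkcond [LHS]big_mkcond; apply: eq_bigr => x _.
  by rewrite inE; case: (x \in A); case: (x \in B).
have -> : (v \in A : nat) = \sum_(x in A) (x == v).
  by rewrite big_mkcond (bigD1 v) //= eqxx big1 ?addn0 => [|x /negbTE ->]; case: ifP.
rewrite cardE [X in _ + X](eq_bigr _ (fun w _ => cardE (branch v w))).
rewrite exchange_big -big_split; apply: eq_bigr => x _ /=.
have [->|xv] := eqVneq x v.
  rewrite mem_branch big1 // => w /andP[evw _]; apply/eqP; rewrite eqb0.
  apply/negP => /branch_avoids; rewrite eqxx => /implyP.
  by rewrite implybF eq_sym edge_neq.
rewrite add0n; case: (boolP (x \in branch u v)) => [xb|xb].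
  have [w [evw wu xw]] := branch_childE euv xb xv.
  rewrite (bigD1 w) ?evw //= xw big1 // => w' /andP[/andP[evw' _] ww'].
  apply/eqP; rewrite eqb0; apply: contraNN ww' => xw'.
  by rewrite (branch_neighbor_eq evw' evw xw' xw).
rewrite big1 // => w /andP[evw wu]; apply/eqP; rewrite eqb0.
by apply: contraNN xb; apply/subsetP/proper_sub/branch_child_proper.
Qed.

Lemma card_children u v : e u v -> #|[set w | e v w && (w != u)]| = (degree e v).-1.
Proof.
move=> euv; rewrite /degree [in RHS](cardsD1 u) in_set (e_sym v) euv /=.
by apply: eq_card => w; rewrite !inE andbC.
Qed.

Lemma branch_leaf u v : e u v -> v \in boundary e -> branch u v = [set v].
Proof.
move=> euv; rewrite in_set => /eqP deg1; apply/setP => x; rewrite in_set1.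
apply/idP/eqP => [xb|->]; last exact: mem_branch.
apply: contraTeq isT => /(branch_childE euv xb)[w [evw wu _]].
have /cards0_eq/setP/(_ w) : #|[set w | e v w && (w != u)]| = 0.
  by rewrite (card_children euv) deg1.
by rewrite in_set in_set0 evw wu.
Qed.

Lemma card_branchC (A : {set T}) u v : e u v ->
  #|A :&: branch u v| + #|A :&: branch v u| = #|A|.
Proof. by move=> euv; rewrite (branch_opposite euv) -setDE cardsID. Qed.

Hypothesis deg_interior : forall x, x \in interior e -> 3 <= degree e x.

(** Induction on the size of the branch: for interior v with k >= 2 children of
    branch sizes n_w and boundary counts a_w, the branch has 1 + sum n_w <=
    1 + sum (2 a_w - 1) = 2 a + 1 - k vertices. *)
Lemma card_branch_le u v : e u v ->
  #|branch u v| < 2 * #|boundary e :&: branch u v|.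
Proof.
have [n] := ubnP #|branch u v|; elim: n u v => // n IH u v lt_n euv.
have [vB|vI] := boolP (v \in boundary e).
  by rewrite branch_leaf // (setIidPr _) ?sub1set ?cards1.
have children_le : \sum_(w | e v w && (w != u)) (#|branch v w| + 1) <=
    2 * \sum_(w | e v w && (w != u)) #|boundary e :&: branch v w|.
  rewrite big_distrr; apply: leq_sum => w /andP[evw wu]; rewrite addn1.
  apply: (IH _ _ _ evw).
  exact: leq_trans (proper_card (branch_child_proper euv evw wu)) _.
move: children_le; rewrite big_split /= -[X in _ + X](_ : (degree e v).-1 = _); last first.
  by rewrite -(card_children euv) -sum1_card; apply: eq_bigl => w; rewrite inE.
have := card_setI_branch setT euv; rewrite setTI in_setT.
under eq_bigr do rewrite setTI.
rewrite (card_setI_branch (boundary e) euv) (negbTE vI) => ->.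
set s := \sum_(_ | _) _; set t := \sum_(_ | _) _.
have : 3 <= degree e v by apply: deg_interior; rewrite in_setC.
lia.
Qed.

Lemma card_tree_le u v : e u v -> #|T| + 2 <= 2 * #|boundary e|.
Proof.
move=> euv; have evu : e v u by rewrite e_sym.
have := card_branch_le euv; have := card_branch_le evu.
have := card_branchC setT euv; have := card_branchC (boundary e) euv.
by rewrite !setTI cardsT; lia.
Qed.

(** The branch found has between L / (2 (D - 1)) and L / 2 boundary vertices; it is
    a child branch of a smallest branch that has at least L / 2 of them. *)
Lemma balanced_edge u0 v0 D : e u0 v0 -> (forall x, degree e x <= D) ->
    3 <= #|boundary e| ->
  exists u v, [/\ e u v, 2 * #|boundary e :&: branch u v| < #|boundary e| &
    #|boundary e| <= 2 * (D.-1 * #|boundary e :&: branch u v|)].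
Proof.
move=> e0 deg_le L3; pose L := #|boundary e|.
pose heavy p := e p.1 p.2 && (L <= 2 * #|boundary e :&: branch p.1 p.2|).
have [p0 hp0] : exists p, heavy p.
  have := card_branchC (boundary e) e0 => half.
  have [le1|lt1] := leqP L (2 * #|boundary e :&: branch u0 v0|).
    by exists (u0, v0); rewrite /heavy e0.
  by exists (v0, u0); rewrite /heavy /= e_sym e0 /=; rewrite -/L in half; lia.
case: (arg_minnP (fun p => #|branch p.1 p.2|) hp0) => -[u v] /andP[/= euv Luv] pmin.
have light w : e v w && (w != u) -> 2 * #|boundary e :&: branch v w| < L.
  move=> /andP[evw wu]; rewrite ltnNge; apply/negP => Lw.
  have := pmin (v, w); rewrite /heavy /= evw Lw => /(_ isT).
  by rewrite leqNgt proper_card // branch_child_proper.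
have vI : v \notin boundary e.
  apply: contraTN Luv => vB; rewrite branch_leaf // (setIidPr _) ?sub1set // cards1.
  by rewrite -ltnNge.
have deg3 : 3 <= degree e v by apply: deg_interior; rewrite in_setC.
have [w /andP[cw Lw]|none] := pickP (fun w => (e v w && (w != u)) &&
    (L <= 2 * (D.-1 * #|boundary e :&: branch v w|))).
  by exists v, w; split=> //; [case/andP: cw|exact: light].
(* Otherwise 2 (D - 1) a_w <= L - 1 for each of the at most D - 1 children w, and
   summing contradicts L <= 2 sum a_w. *)
have sum_le : \sum_(w | e v w && (w != u)) (2 * (D.-1 * #|boundary e :&: branch v w|) + 1) <=
    (degree e v).-1 * L.
  rewrite -(card_children euv) -sum_nat_const big_mkcond [leqRHS]big_mkcond.
  apply: leq_sum => w _; rewrite in_set; case: ifP => // cw.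
  by have := none w; rewrite cw /= addn1 ltnNge => ->.
move: sum_le; rewrite big_split /= -!big_distrr /=.
rewrite -[X in _ + X](_ : (degree e v).-1 = _); last first.
  by rewrite -(card_children euv) -sum1_card; apply: eq_bigl => w; rewrite inE.
move: Luv; rewrite (card_setI_branch (boundary e) euv) (negbTE vI) add0n.
set s := \sum_(_ | _) _ => Luv sum_le.
have : D.-1 * L <= 2 * (D.-1 * s) by rewrite mulnCA leq_mul2l Luv orbT.
by have := deg_le v; nia.
Qed.

End Branch.

(** * The bound on the first nonzero eigenvalue *)

Local Open Scope ring_scope.

Theorem theorem1p2 (R : realType) (T : finType) (e : rel T) (D : nat)
    (e_tree : is_tree e) (T_ge3 : (3 <= #|T|)%N) (D_gt0 : (0 < D)%N)
    (deg_le : forall x : T, (degree e x <= D)%N)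
    (deg_interior : forall x : T, x \in interior e -> (3 <= degree e x)%N) :
  steklov_eigenvalue R e 2 <= 8 * (D%:R - 1) / (#|T|%:R + 2).
Proof.
have [e_sym _ e_conn _] := e_tree.
have [u0 [v0 e0]] : exists u v, e u v.
  have [x [y xy]] : exists x y : T, x != y.
    have /card_gt1P[x [y [_ _ xy]]] : (1 < #|T|)%N by apply: leq_trans T_ge3.
    by exists x, y.
  have /connectP[[|z p] /= + yE] := e_conn x y; first by rewrite yE eqxx in xy.
  by case/andP; exists x, z.
have TL := card_tree_le e_tree deg_interior e0.
have [|u [v [euv light heavy]]] := balanced_edge e_tree deg_interior e0 deg_le.
  by move: TL T_ge3; lia.
have LE := cardsID (branch e u v) (boundary e).
have cut := @steklov_cut_le R T e e_sym e_conn (branch e u v).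
move: (card_branch_cut e_tree euv) light heavy LE TL cut.
set m := #|[set p : T * T | _]|; set a := #|boundary e :&: _|; set b := #|boundary e :\: _|.
move=> m_le1 light heavy LE TL cut.
have a_gt0 : (0 < a)%N by move: heavy light; case: (a) => //; lia.
have b_gt0 : (0 < b)%N by lia.
(* With L = a + b: L <= 2 (D - 1) a, L <= 2 b and |V| + 2 <= 2 L. *)
have ineqN : ((#|T| + 2) * (a + b) <= 8 * D.-1 * (a * b))%N.
  have -> : (a + b = #|boundary e|)%N by [].
  have : (#|boundary e| * #|boundary e| <= (2 * (D.-1 * a)) * (2 * b))%N.
    by apply: leq_mul => //; lia.
  by nia.
have a0 : 0 < a%:R :> R by rewrite ltr0n.
have b0 : 0 < b%:R :> R by rewrite ltr0n.
apply: (le_trans (cut a_gt0 b_gt0)).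
have -> : D%:R - 1 = D.-1%:R :> R by rewrite -subn1 natrB.
apply: (@le_trans _ _ ((a + b)%:R / (a * b)%:R)).
  have -> : (a + b)%:R / (a * b)%:R = 1 * (a%:R^-1 + b%:R^-1) :> R.
    by rewrite natrD natrM; field; rewrite !gt_eqF.
  by apply: ler_wpM2r; [rewrite addr_ge0 ?invr_ge0 // ltW|rewrite lern1].
rewrite -natrD -natrM ler_pdivrMr ?ltr0n ?muln_gt0 ?a_gt0 //.
rewrite mulrAC ler_pdivlMr ?ltr0n ?addn2 // -!natrM ler_nat -addn2.
by rewrite mulnC.
Qed.
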